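(* Let $F$ be the fractal percolation in $[0,1]^2$ with parameters $M\in\mathbb{N}_{\geq 2}$ and $p\in(1/M^2,1]$, let $D=\log(M^2p)/\log M$, $r=1/M$, and $\overline{\mathcal V}_k(F):=\lim_{n\to\infty} r^{n(D-k)}\mathbb{E}V_k(F_n)$. Then these limits exist and $$\overline{\mathcal V}_2(F)=1,\qquad \overline{\mathcal V}_1(F)=\frac{2M(1-p)}{M-p},$$ $$\overline{\mathcal V}_0(F)=1-\frac{2p(M-1)^2}{M-p}\left(\frac{3}{M-1}-\frac{4p}{M-p}+\frac{p^2}{M-p^2}\right)+\frac{2p(M^2-1)}{M^2-p}-\frac{4p^2(M-1)^2}{(M-p)^2}+\frac{p^3(M-1)^2(M+p^2)}{(M-p^2)(M^2-p^3)}.$$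
   Context: Fractal percolation in $[0,1]^d$ (here $d=2$) with parameters $M\geq2$, $p\in[0,1]$: $F_0:=[0,1]^d$; given $F_{n-1}$, a union of closed grid cubes of side $M^{-(n-1)}$, each such cube is divided into $M^d$ closed subcubes of side $M^{-n}$, each kept independently (of everything else) with probability $p$; $F_n$ is the union of kept subcubes, $F=\bigcap_n F_n$. $V_0,V_1,V_2$ are the intrinsic volumes (Euler characteristic, half the perimeter, area) extended additively to finite unions of compact convex sets. *)

(* Defs.v *)
From HB Require Import structures.
From mathcomp Require Import all_boot all_order all_algebra.
From mathcomp Require Import all_classical all_reals all_analysis.
Set Implicit Arguments. Unset Strict Implicit. Unset Printing Implicit Defensive.
Import Order.TTheory GRing.Theory Num.Theory.
Local Open Scope ring_scope.

(* Grid squares at level n are indexed by (i,j) : 'I_(M^n) * 'I_(M^n), the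
   closed square [i/M^n,(i+1)/M^n] x [j/M^n,(j+1)/M^n]. *)

Definition ord_div (N d : nat) (c : 'I_N) : 'I_N :=
  Ordinal (leq_ltn_trans (leq_div c d) (ltn_ord c)).

(* Random variables of the construction up to level n: one Bernoulli(p)
   variable for each level m (1 <= m <= n) and each level-m square (i,j)
   (i,j < M^m); entries with m = 0 or i,j >= M^m are unused dummies, which
   do not affect expectations. *)
Definition cell (M n : nat) := ('I_n.+1 * ('I_(M ^ n) * 'I_(M ^ n)))%type.

(* F_n as the set of kept level-n squares: a level-n square is in F_n iff
   it and all its ancestors at levels 1..n were retained. *)
Definition kept (M n : nat) (w : {ffun cell M n -> bool}) :
    {set 'I_(M ^ n) * 'I_(M ^ n)} :=
  [set c | [forall m : 'I_n.+1, (0 < m)%N ==>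
      w (m, (ord_div (M ^ (n - m)) c.1, ord_div (M ^ (n - m)) c.2))]].

Definition weight (R : fieldType) (M n : nat) (p : R)
    (w : {ffun cell M n -> bool}) : R :=
  \prod_(t : cell M n) (if w t then p else 1 - p).

(* intrinsic volumes V_0, V_1, V_2 of a (possibly degenerate) axis-parallel
   rectangle with side lengths a, b (a nonempty compact convex set) *)
Definition Vbox (R : fieldType) (k : nat) (a b : R) : R :=
  match k with 0 => 1 | 1 => a + b | 2 => a * b | _ => 0 end.

(* bounds of the intersection of the squares in J (first coordinate if
   f = fst, second if f = snd), in units of 1/N *)
Definition box_lo N (J : {set 'I_N * 'I_N}) (f : 'I_N * 'I_N -> 'I_N) : nat :=
  \max_(c in J) (f c : nat).
Definition box_hi N (J : {set 'I_N * 'I_N}) (f : 'I_N * 'I_N -> 'I_N) : nat :=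
  \big[minn/N]_(c in J) (f c).+1.

Definition Vcap (R : fieldType) (k N : nat) (J : {set 'I_N * 'I_N}) : R :=
  let lo1 := box_lo J fst in let hi1 := box_hi J fst in
  let lo2 := box_lo J snd in let hi2 := box_hi J snd in
  if ((lo1 <= hi1) && (lo2 <= hi2))%N
  then Vbox (R:=R) k ((hi1 - lo1)%:R / N%:R) ((hi2 - lo2)%:R / N%:R)
  else 0.

(* additive extension of V_k to the union of the closed squares in S
   (inclusion-exclusion) *)
Definition Vk (R : fieldType) (k N : nat) (S : {set 'I_N * 'I_N}) : R :=
  \sum_(J : {set 'I_N * 'I_N} | (J \subset S) && (J != finset.set0))
     (-1) ^+ (#|J|.+1) * Vcap R k J.

Definition EVk (R : fieldType) (M : nat) (p : R) (k n : nat) : R :=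
  \sum_(w : {ffun cell M n -> bool}) weight p w * Vk R k (kept w).

(* Main.v *)
(* Expanding each V_k(F_n) by inclusion-exclusion and taking expectations, a set
   J of level-n squares contributes its box volume times p^(number of ancestors,
   J included), and only sets with a common point matter: single squares, pairs sharing
   an edge, and the seven ways to surround a vertex. For a pair on the grid line
   x, or a set around the vertex (x, y), the number of ancestors is n plus an
   expression in the depths a and b at which x and y become grid lines, and
   depth a occurs (M - 1) M^(n - a) times among 0 < x < M^n for 1 <= a <= n.
   After normalization everything is a combination of geometric sums. *)
Require Import Defs.
From HB Require Import structures.
From mathcomp Require Import all_boot all_order all_algebra.
From mathcomp Require Import all_classical all_reals all_analysis.
From mathcomp Require Import zify ring lra.
Import Order.TTheory GRing.Theory Num.Theory numFieldNormedType.Exports.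
Local Open Scope ring_scope.
Local Open Scope classical_set_scope.
Set Implicit Arguments. Unset Strict Implicit. Unset Printing Implicit Defensive.

(** * Survival probability of a set of squares *)

(** The indicator is itself a product over [t], so the sum over [w] factors into one sum over [bool]
    per coordinate: [p] on [A], [p + (1 - p) = 1] off it. *)
Lemma bernoulli_all (R : fieldType) (T : finType) (p : R) (A : {set T}) :
  \sum_(w : {ffun T -> bool})
    (\prod_t (if w t then p else 1 - p)) * [forall t in A, w t]%:R = p ^+ #|A|.
Proof.
pose F t (b : bool) : R := (if b then p else 1 - p) * ((t \in A) ==> b)%:R.
transitivity (\prod_t \sum_b F t b).
  rewrite bigA_distr_bigA; apply: eq_bigr => w _; rewrite big_split /=.
  congr (_ * _); rewrite -natr_prod; congr (_%:R).
  case: forallP => [wA|/forallP].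
    by rewrite big1 // => t _; rewrite (wA t).
  rewrite negb_forall => /existsP[t /negbTE wt].
  by rewrite (bigD1 t) //= wt.
rewrite -prodr_const [RHS]big_mkcond; apply: eq_bigr => t _.
by rewrite big_bool /F; case: (t \in A) => /=; ring.
Qed.

Definition anc (M n : nat) (m : nat) (c : 'I_(M ^ n) * 'I_(M ^ n)) :=
  (ord_div (M ^ m) c.1, ord_div (M ^ m) c.2).

Definition ancestry (M n : nat) (J : {set 'I_(M ^ n) * 'I_(M ^ n)}) :
    {set cell M n} :=
  [set t : cell M n | (0 < t.1)%N & t.2 \in @anc M n (n - t.1) @: J].

Lemma subset_kept (M n : nat) (w : {ffun cell M n -> bool})
    (J : {set 'I_(M ^ n) * 'I_(M ^ n)}) :
  (J \subset kept w) = [forall t in ancestry J, w t].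
Proof.
apply/fintype.subsetP/forall_inP => [Jw [m c]|Aw c cJ].
  by rewrite inE /= => /andP[m0 /imsetP[d /Jw]]; rewrite inE => /forallP/(_ m);
    rewrite m0 /= => ? ->.
rewrite inE; apply/forallP => m; apply/implyP => m0; apply: Aw.
by rewrite inE /= m0; apply/imsetP; exists c.
Qed.

Lemma EVk_ancestry (R : fieldType) (M n k : nat) (p : R) :
  EVk M p k n = \sum_(J : {set 'I_(M ^ n) * 'I_(M ^ n)} | J != finset.set0)
    (-1) ^+ #|J|.+1 * Vcap R k J * p ^+ #|ancestry J|.
Proof.
rewrite /EVk /Vk.
under eq_bigr => w _ do rewrite big_mkcondl mulr_sumr.
rewrite exchange_big; apply: eq_bigr => J _.
rewrite -bernoulli_all mulr_sumr; apply: eq_bigr => w _.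
rewrite /weight subset_kept; case: ifP => _; rewrite ?mulr1 ?mulr0 //.
by rewrite mulrC.
Qed.

Lemma card_ancestry (M n : nat) (J : {set 'I_(M ^ n) * 'I_(M ^ n)}) :
  #|ancestry J| = (\sum_(j < n) #|@anc M n j @: J|)%N.
Proof.
transitivity (\sum_m \sum_c ((m, c) \in ancestry J))%N.
  rewrite pair_bigA -sum1_card big_mkcond; apply: eq_bigr => -[m c] _ /=.
  by case: (_ \in _).
(* Level 0 contributes nothing; levels 1 to [n] are reversed, so that [j] counts the steps upwards
   from level [n]. *)
rewrite big_ord_recl big1 ?add0n => [|c _]; last by rewrite inE.
rewrite (reindex_inj rev_ord_inj); apply: eq_bigr => j _.
rewrite -sum1_card [RHS]big_mkcond; apply: eq_bigr => c _.
have jn := ltn_ord j; rewrite inE /= (_ : (n - _)%N = j); last first.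
  by rewrite /= /bump; lia.
by case: (_ \in _).
Qed.

(** * Common box of a set of squares *)

(* For nonempty J: the squares of J have a common point in the direction f, and
   the lower end of the common interval is x. *)
Definition touch N (J : {set 'I_N * 'I_N}) (f : 'I_N * 'I_N -> 'I_N) (x : nat) :=
  [forall c in J, (f c <= x <= (f c).+1)%N] && [exists c in J, f c == x :> nat].

Lemma box_lo_leq N (J : {set 'I_N * 'I_N}) f m :
  (box_lo J f <= m)%N = [forall c in J, (f c <= m)%N].
Proof. by apply/bigmax_leqP/forall_inP. Qed.

Lemma leq_box_hi N (J : {set 'I_N * 'I_N}) f m : J != finset.set0 ->
  (m <= box_hi J f)%N = [forall c in J, (m <= (f c).+1)%N].
Proof.
move=> /set0Pn[c0 c0J].
(* The default value [N] of the minimum adds the condition [m <= N]; a member of [J] implies it. *)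
have E r : (m <= \big[minn/N]_(c <- r | c \in J) (f c).+1)%N =
    (m <= N)%N && all (fun c => (c \in J) ==> (m <= (f c).+1)%N) r.
  elim: r => [|c r IHr]; first by rewrite big_nil andbT.
  by rewrite big_cons /=; case: (c \in J); rewrite //= leq_min IHr andbCA.
rewrite /box_hi E; apply/andP/forall_inP => [[_ /allP H] c|H].
  by apply/implyP/H; rewrite mem_index_enum.
split; first exact: leq_trans (H _ c0J) (ltn_ord _).
by apply/allP => c _; apply/implyP/H.
Qed.

Lemma box_loE N (J : {set 'I_N * 'I_N}) f x : J != finset.set0 ->
  (box_lo J f == x) && (box_lo J f <= box_hi J f)%N = touch J f x.
Proof.
move=> J0; have [c0 c0J] := set0Pn _ J0.
have [c1 c1J Ec1] : {c | c \in J & box_lo J f = f c}.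
  by apply: eq_bigmax_cond; rewrite card_gt0.
rewrite leq_box_hi //; apply/andP/andP => [[/eqP Ex /forall_inP H]|].
  split; last by apply/exists_inP; exists c1; rewrite // -Ec1 Ex.
  apply/forall_inP => c cJ; rewrite -Ex H // andbT.
  by move: c cJ; apply/forall_inP; rewrite -box_lo_leq.
case=> /forall_inP H /exists_inP[c cJ /eqP Ec].
have Ex : box_lo J f = x.
  apply/eqP; rewrite eqn_leq box_lo_leq.
  apply/andP; split; first by apply/forall_inP => d /H/andP[].
  rewrite -Ec; move: c cJ {Ec}; apply/forall_inP; by rewrite -box_lo_leq.
by split; [rewrite Ex | apply/forall_inP => d /H/andP[]; rewrite Ex].
Qed.

(** By [touch], a member with [f c] different from [x] has [f c = x - 1], hence upper end [x], and
    the common interval is a point. Without such a member every upper end is [x + 1]. *)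
Lemma box_hiE N (J : {set 'I_N * 'I_N}) f x : J != finset.set0 -> touch J f x ->
  (box_hi J f - box_lo J f)%N = [forall c in J, f c == x :> nat].
Proof.
move=> J0 Jx; have := Jx; rewrite -box_loE // => /andP[/eqP -> _].
case/andP: Jx => /forall_inP H _; have [c0 c0J] := set0Pn _ J0.
have x_hi : (x <= box_hi J f)%N.
  by rewrite leq_box_hi //; apply/forall_inP => c /H/andP[].
case: forall_inP => [Ex|/forall_inP].
  have := leq_box_hi f x.+1 J0; have := leq_box_hi f x.+2 J0.
  have -> : [forall c in J, (x.+1 < (f c).+1)%N] = false.
    by apply/negbTE/forall_inPn; exists c0; rewrite //= (eqP (Ex _ c0J)) ltnn.
  have -> : [forall c in J, (x < (f c).+1)%N] = true.
    by apply/forall_inP => c /Ex /eqP ->.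
  lia.
case/forall_inPn => c cJ nEc.
have : ~~ (x < box_hi J f)%N.
  rewrite leq_box_hi //; apply/forall_inPn; exists c => //=.
  have /andP[] := H _ cJ; move: nEc; rewrite /=; lia.
by move: x_hi; rewrite /=; lia.
Qed.

(** * Sets of squares with a given lower left corner *)

Definition predI N (x : 'I_N) : 'I_N :=
  Ordinal (leq_ltn_trans (leq_pred x) (ltn_ord x)).

(* The squares around the corner (x, y), selected in the order upper right, upper
   left, lower right, lower left. *)
Definition block N (x y : 'I_N) (t : bool * bool * bool * bool) : seq ('I_N * 'I_N) :=
  let: (a, b, c, d) := t in
  nseq a (x, y) ++ nseq b (predI x, y) ++ nseq c (x, predI y)
  ++ nseq d (predI x, predI y).

(* Truncated predecessor makes the squares of [block] coincide when x = 0 or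
   y = 0; the last two conditions exclude this. *)
Definition cornered N (x y : 'I_N) (t : bool * bool * bool * bool) : bool :=
  let: (a, b, c, d) := t in
  [&& a || c, a || b, (b || d) ==> (0 < x)%N & (c || d) ==> (0 < y)%N].

Lemma predI_eq N (x : 'I_N) : (predI x == x) = ~~ (0 < x)%N.
Proof. by rewrite -val_eqE /=; lia. Qed.

Lemma touch_seq N (s : seq ('I_N * 'I_N)) f x :
  touch [set z in s]%SET f x =
  all (fun c => f c <= x <= (f c).+1)%N s && has (fun c => f c == x :> nat) s.
Proof.
congr (_ && _).
  by apply/forall_inP/allP => H c; have := H c; rewrite inE.
by apply/exists_inP/hasP => -[c]; rewrite ?inE => cs H; exists c; rewrite // inE.
Qed.

Lemma card_set_seq (T : finType) (s : seq T) : #|[set z in s]%SET| = size (undup s).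
Proof.
by rewrite cardsE -(card_uniqP (undup_uniq s)); apply: eq_card => z; rewrite mem_undup.
Qed.

(** Both coordinates of a member of [J] are at most one below those of the corner, so [J] is
    determined by which of four squares it contains. *)
Lemma sum_touch (V : nmodType) N (x y : 'I_N) (F : {set 'I_N * 'I_N} -> V) :
  \sum_(J | touch J fst x && touch J snd y) F J =
  \sum_(t | cornered x y t) F [set z in block x y t]%SET.
Proof.
(* The positivity guards keep a square from being recorded a second time when [predI] fixes 0. *)
pose h' (J : {set 'I_N * 'I_N}) := ((x, y) \in J, (0 < x)%N && ((predI x, y) \in J),
  (0 < y)%N && ((x, predI y) \in J),
  [&& (0 < x)%N, (0 < y)%N & (predI x, predI y) \in J]).
rewrite (reindex_onto (fun t => [set z in block x y t]%SET) h') => [|J].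
  apply: eq_bigl => t; rewrite !touch_seq /h' !inE.
  have ex := predI_eq x; have ey := predI_eq y.
  have ex' : (x == predI x) = ~~ (0 < x)%N by rewrite eq_sym.
  have ey' : (y == predI y) = ~~ (0 < y)%N by rewrite eq_sym.
  have nx : (x.-1 == x) = ~~ (0 < x)%N by lia.
  have ny : (y.-1 == y) = ~~ (0 < y)%N by lia.
  have bx : (x.-1 <= x <= x.-1.+1)%N by lia.
  have by' : (y.-1 <= y <= y.-1.+1)%N by lia.
  case: t => [[[[] []] []] []]; rewrite /= ?inE ?xpair_eqE ?ex ?ey ?ex' ?ey' ?nx ?ny
    ?bx ?by' ?leqnn ?leqnSn ?eqxx /=; by do 2 case: (0 < _)%N.
case/andP => /andP[/forall_inP Jx _] /andP[/forall_inP Jy _].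
apply/setP => z; rewrite inE !mem_cat !mem_nseq !lt0b.
apply/idP/idP => [|zJ]; first by
  case/or4P => [/andP[? /eqP->]|/andP[/andP[? ?] /eqP->]|/andP[/andP[? ?] /eqP->]
    |/andP[/and3P[? ? ?] /eqP->]].
have zx : (z.1 == x) || (0 < x)%N && (z.1 == predI x).
  by have := Jx _ zJ; rewrite -!val_eqE /=; lia.
have zy : (z.2 == y) || (0 < y)%N && (z.2 == predI y).
  by have := Jy _ zJ; rewrite -!val_eqE /=; lia.
case: z zJ zx zy => u v /= zJ /orP[/eqP|/andP[-> /eqP]] Eu /orP[/eqP|/andP[-> /eqP]] Ev;
  by rewrite -Eu -Ev zJ !eqxx ?orbT.
Qed.

Lemma sum_bool4 (V : nmodType) (P : pred (bool * bool * bool * bool)) (F : _ -> V) :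
  \sum_(t | P t) F t =
  \sum_(a : bool) \sum_(b : bool) \sum_(c : bool) \sum_(d : bool)
    if P (a, b, c, d) then F (a, b, c, d) else 0.
Proof.
by rewrite big_mkcond !pair_bigA; apply: eq_bigr => -[[[a b] c] d].
Qed.

(** * Counting ancestors by the depths of grid lines *)

(* The squares on either side of the line x have different ancestors j levels up
   exactly when M^j divides x. *)
Definition pdepth (M n x : nat) : nat := (\sum_(j < n) (M ^ j %| x))%N.

Lemma predn_div d x : (0 < x)%N -> (x.-1 %/ d == x %/ d)%N = ~~ (d %| x)%N.
Proof.
case: x => // x _; case: d => [|d]; first by rewrite !divn0.
by rewrite (divnS x (ltn0Sn d)) /=; case: (_ %| _)%N; lia.
Qed.

(** The exponents [j] with [M ^ j %| x] are closed downwards, so those for [x] and for [y] form two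
    initial segments. *)
Lemma pdepth_nested M n x y :
  (forall j, j < n -> M ^ j %| x -> M ^ j %| y)%N \/
  (forall j, j < n -> M ^ j %| y -> M ^ j %| x)%N.
Proof.
case: (boolP [forall j : 'I_n, (M ^ j %| x) ==> (M ^ j %| y)]%N) => [/forallP H|].
  by left=> j jn; apply/implyP/(H (Ordinal jn)).
rewrite negb_forall => /existsP[i]; rewrite negb_imply => /andP[ix iy].
right=> j jn jy; apply: dvdn_trans ix; apply: dvdn_exp2l.
by rewrite leqNgt; apply: contra iy => ij; apply: dvdn_trans jy; apply/dvdn_exp2l/ltnW.
Qed.

Lemma pdepth_min M n x y :
  (\sum_(j < n) ((M ^ j %| x) && (M ^ j %| y)) = minn (pdepth M n x) (pdepth M n y))%N.
Proof.
have le u v : (forall j, j < n -> M ^ j %| u -> M ^ j %| v)%N ->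
    (\sum_(j < n) ((M ^ j %| u) && (M ^ j %| v)) = pdepth M n u)%N /\
    (pdepth M n u <= pdepth M n v)%N.
  move=> H; split; first apply: eq_bigr => j _; last apply: leq_sum => j _;
    have := H j (ltn_ord j); by do 2 case: (_ %| _)%N => // /(_ isT).
case: (pdepth_nested M n x y) => /le[E /minn_idPl m]; first by rewrite m -E.
by rewrite minnC m -E; apply: eq_bigr => j _; rewrite andbC.
Qed.

Lemma pdepth_max M n x y :
  (\sum_(j < n) ((M ^ j %| x) || (M ^ j %| y)) = maxn (pdepth M n x) (pdepth M n y))%N.
Proof.
apply/eqP; rewrite -(eqn_add2r (minn (pdepth M n x) (pdepth M n y))) [X in _ == X]addnC addn_min_max.
rewrite -pdepth_min /pdepth -!big_split; apply/eqP/eq_bigr => j _ /=.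
by do 2 case: (_ %| _)%N.
Qed.

(** Let [u] and [v] indicate whether the lines [x] and [y] separate ancestors at a given level. The
    distinct ancestors there exceed one by [u] or [v] for an edge pair, [u || v] for a diagonal
    pair, [u + v] for three squares (the last case), and [u + v + u * v] for all four. Summed over
    the levels, disjunction becomes [maxn] and conjunction [minn]. *)
Definition extra_ancestors (t : bool * bool * bool * bool) (a b : nat) : nat :=
  match t with
  | (true, false, false, false) => 0
  | (true, true, false, false) => a
  | (true, false, true, false) => b
  | (true, true, true, true) => a + b + minn a b
  | (true, false, false, true) | (false, true, true, false) => maxn a b
  | _ => a + b
  end.

Lemma card_block N (x y : 'I_N) (t : bool * bool * bool * bool) : cornered x y t ->
  #|[set z in block x y t]%SET| = (let: (a, b, c, d) := t in a + b + c + d)%N.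
Proof.
have ex := predI_eq x; have ey := predI_eq y.
have ex' : (x == predI x) = ~~ (0 < x)%N by rewrite eq_sym.
have ey' : (y == predI y) = ~~ (0 < y)%N by rewrite eq_sym.
case: t => [[[a b] c] d]; rewrite card_set_seq.
move: a b c d => [] [] [] [] //= H; move: H;
 rewrite ?inE ?xpair_eqE ?ex ?ey ?ex' ?ey' ?eqxx /=; by do 2 case: (0 < _)%N.
Qed.

Lemma imset_set_seq (T U : finType) (f : T -> U) (s : seq T) :
  f @: [set z in s]%SET = [set z in map f s]%SET.
Proof.
apply/setP => z; rewrite inE.
by apply/imsetP/mapP => -[w]; rewrite ?inE => ws ->; exists w; rewrite // inE.
Qed.

Lemma card_ancestry_block M n (x y : 'I_(M ^ n)) t : cornered x y t ->
  #|ancestry [set z in block x y t]%SET| = (n + extra_ancestors t (pdepth M n x) (pdepth M n y))%N.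
Proof.
move=> tP; rewrite card_ancestry.
under eq_bigr => j _ do rewrite imset_set_seq card_set_seq.
have eo (z : 'I_(M ^ n)) j : (0 < z)%N -> (ord_div (M ^ j) (predI z) == ord_div (M ^ j) z)
    = ~~ (M ^ j %| z)%N by move=> z0; rewrite -val_eqE /= predn_div.
have eo' (z : 'I_(M ^ n)) j : (0 < z)%N -> (ord_div (M ^ j) z == ord_div (M ^ j) (predI z))
    = ~~ (M ^ j %| z)%N by move=> z0; rewrite eq_sym eo.
transitivity (\sum_(j < n) 1 + extra_ancestors t (pdepth M n x) (pdepth M n y))%N; last first.
  by rewrite sum1_card card_ord.
rewrite /extra_ancestors -pdepth_min -pdepth_max /pdepth.
case: t tP => [[[[] []] []] []] //= tP; rewrite ?addn0 -?big_split; apply: eq_bigr => j _;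
 rewrite /anc /= ?inE ?xpair_eqE ?eqxx ?eo ?eo' //=; try (by move: tP; lia);
 by case: (M ^ j %| x)%N; case: (M ^ j %| y)%N.
Qed.

(** * Expectation as a sum over lower left corners *)

(** At most one [(x, y)] passes both tests, the lower left corner of the common box, and none does
    if that box is empty. This lets the sets [J] be grouped by corner. *)
Lemma Vcap_sum_touch (R : fieldType) N k (J : {set 'I_N * 'I_N}) (F : R) :
  J != finset.set0 ->
  Vcap R k J * F = \sum_(x : 'I_N) \sum_(y : 'I_N) if touch J fst x && touch J snd y then
    Vbox k ([forall c in J, c.1 == x]%:R / N%:R) ([forall c in J, c.2 == y]%:R / N%:R) * F
    else 0.
Proof.
move=> J0; have [c cJ] := set0Pn _ J0.
have N0 : (0 < N)%N := leq_ltn_trans (leq0n _) (ltn_ord c.1).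
have lo_lt f : (box_lo J f < N)%N.
  apply: (@leq_ltn_trans N.-1); last by lia.
  by rewrite box_lo_leq; apply/forall_inP => d _; have := ltn_ord (f d); lia.
have touch_lo f (x : 'I_N) : touch J f x -> x = Ordinal (lo_lt f).
  by rewrite -box_loE // => /andP[/eqP E _]; apply: val_inj.
rewrite (bigD1 (Ordinal (lo_lt fst))) //= [X in _ + X]big1 ?addr0; last first.
  move=> x /eqP nx; apply: big1 => y _; case: ifP => // /andP[/touch_lo]; by [].
rewrite (bigD1 (Ordinal (lo_lt snd))) //= [X in _ + X]big1 ?addr0; last first.
  move=> y /eqP ny; case: ifP => // /andP[_ /touch_lo]; by [].
rewrite /Vcap -!box_loE //= !eqxx /=; case: ifP => [/andP[t1 t2]|]; last by rewrite mul0r.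
have T1 : touch J fst (box_lo J fst) by rewrite -box_loE // eqxx.
have T2 : touch J snd (box_lo J snd) by rewrite -box_loE // eqxx.
by rewrite (box_hiE J0 T1) (box_hiE J0 T2).
Qed.

(** An edge pair flattens the box in one direction. The sets around a vertex leave a point: two
    diagonal pairs give the coefficient -2, four triples 4, the full block -1. *)
Lemma block_sum (R : fieldType) M n k (p : R) (x y : 'I_(M ^ n)) :
  let V := fun a b => Vbox (R := R) k (a / (M ^ n)%:R) (b / (M ^ n)%:R) in
  let a := pdepth M n x in let b := pdepth M n y in
  \sum_(J | touch J fst x && touch J snd y)
    (-1) ^+ #|J|.+1 * V [forall c in J, c.1 == x]%:R [forall c in J, c.2 == y]%:R
      * p ^+ #|ancestry J|
  = p ^+ n * (V 1 1 - (V 0 1 * p ^+ a) *+ (0 < x)%N - (V 1 0 * p ^+ b) *+ (0 < y)%N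
      + (V 0 0 * (- 2 * p ^+ maxn a b + 4 * p ^+ (a + b) - p ^+ (a + b + minn a b)))
         *+ ((0 < x) && (0 < y))%N).
Proof.
move=> V a b; rewrite sum_touch.
have all_seq (f : 'I_(M ^ n) * 'I_(M ^ n) -> 'I_(M ^ n)) z s :
    [forall c in [set w in s]%SET, f c == z] = all (fun c => f c == z) s.
  by apply/forall_inP/allP => H c; have := H c; rewrite inE.
under eq_bigr => t tP do
  rewrite (card_block tP) (card_ancestry_block tP) exprD (all_seq fst) (all_seq snd).
rewrite sum_bool4 !big_bool /=.
rewrite !predI_eq !eqxx -/a -/b; move: V (p ^+ n) (p ^+ a) (p ^+ b) (p ^+ (a + b))
  (p ^+ maxn a b) (p ^+ (a + b + _)) => {all_seq a b} V q pa pb pab pm pq.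
by case: (0 < x)%N; case: (0 < y)%N; rewrite /= ?addr0 ?add0r ?mulr0n ?mulr1n; ring.
Qed.

Lemma EVk_pdepth (R : fieldType) M n k (p : R) :
  let V := fun a b => Vbox (R := R) k (a / (M ^ n)%:R) (b / (M ^ n)%:R) in
  EVk M p k n = p ^+ n * \sum_(x < M ^ n) \sum_(y < M ^ n)
    let a := pdepth M n x in let b := pdepth M n y in
    (V 1 1 - (V 0 1 * p ^+ a) *+ (0 < x)%N - (V 1 0 * p ^+ b) *+ (0 < y)%N
      + (V 0 0 * (- 2 * p ^+ maxn a b + 4 * p ^+ (a + b) - p ^+ (a + b + minn a b)))
         *+ ((0 < x) && (0 < y))%N).
Proof.
move=> V; rewrite EVk_ancestry mulr_sumr.
under eq_bigr => J J0 do rewrite -mulrA mulrCA Vcap_sum_touch //.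
rewrite exchange_big; apply: eq_bigr => x _; rewrite mulr_sumr exchange_big.
apply: eq_bigr => y _; rewrite -block_sum -big_mkcondr; apply: eq_big => [J|J _].
  apply/andb_idl => /andP[/andP[_ /exists_inP[c cJ _]] _].
  by apply/set0Pn; exists c.
by rewrite /V [in LHS]mulrC -!mulrA; congr (_ * _); rewrite mulrC.
Qed.

(** * Distribution of the depths *)

Lemma pdepthS M n q s : (0 < M)%N -> (s < M)%N ->
  pdepth M n.+1 (q * M + s) = (if s == 0 then (pdepth M n q).+1 else 1)%N.
Proof.
move=> M0 sM; rewrite /pdepth big_ord_recl expn0 dvd1n.
case: s sM => [|s] sM /=.
  rewrite addn0 add1n; congr _.+1; apply: eq_bigr => j _.
  by rewrite /= /bump add1n expnSr dvdn_pmul2r.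
rewrite big1 // => j _; rewrite /= /bump add1n expnSr.
case: (boolP (_ %| _)%N) => // H; exfalso.
have := dvdn_trans (dvdn_mull _ (dvdnn M)) H.
by rewrite dvdn_addr ?dvdn_mull // gtnNdvd.
Qed.

(** Induction on [n] with [x = q * M + s]: remainder 0 adds one to the depth of [q], and each of the
    [M - 1] other remainders gives depth 1. The shift of [G] requires the statement for all [G]. *)
Lemma sum_pdepth (V : nmodType) M n (G : nat -> V) : (0 < M)%N ->
  \sum_(x < M ^ n) G (pdepth M n x) *+ (0 < x)%N =
  \sum_(i < n) G i.+1 *+ (M.-1 * M ^ (n - i.+1))%N.
Proof.
case: M => // m _; elim: n G => [|n IHn] G.
  by rewrite expn0 big_ord1 big_ord0 mulr0n.
rewrite big_ord_recl /= -(big_mkord xpredT (fun x => G (pdepth m.+1 n.+1 x) *+ (0 < x)%N)).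
rewrite expnSr big_nat_mul big_mkord.
transitivity (\sum_(q < m.+1 ^ n) (G (pdepth m.+1 n q).+1 *+ (0 < q)%N + G 1 *+ m)).
  apply: eq_bigr => q _.
  rewrite mulSn -{1}(add0n (q * m.+1)%N) big_addn addnK big_mkord.
  rewrite big_ord_recl /= addnC pdepthS //.
  congr (_ + _); first by rewrite addn0 muln_gt0 andbT.
  transitivity (\sum_(s < m) G 1%N); last by rewrite sumr_const card_ord.
  by apply: eq_bigr => s _; rewrite /= /bump add1n addnC pdepthS ?ltnS ?ltn_ord //= addnS.
rewrite big_split /= sumr_const card_ord -mulrnA subSS subn0 addrC; congr (_ + _).
by rewrite (IHn (fun a => G a.+1)); apply: eq_bigr => j _; rewrite /bump add1n subSS.
Qed.

(** * Closed forms of the sums over depths *)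

Definition maxmin_sum (R : fieldType) n (s t : R) : R :=
  \sum_(i < n) \sum_(j < n) s ^+ (maxn i j).+1 * t ^+ (minn i j).+1.

Definition geo_sum (R : fieldType) n (s : R) : R := \sum_(i < n) s ^+ i.+1.

Lemma maxmin_sumS (R : fieldType) n (s t : R) :
  maxmin_sum n.+1 s t =
  maxmin_sum n s t + 2 * s ^+ n.+1 * geo_sum n t + s ^+ n.+1 * t ^+ n.+1.
Proof.
rewrite /maxmin_sum big_ord_recr /= big_ord_recr /= maxnn minnn addrA; congr (_ + _).
under eq_bigr => i _ do rewrite big_ord_recr /= (maxn_idPr (ltnW (ltn_ord i)))
  (minn_idPl (ltnW (ltn_ord i))).
under [X in _ + X = _]eq_bigr => i _ do rewrite (maxn_idPl (ltnW (ltn_ord i)))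
  (minn_idPr (ltnW (ltn_ord i))).
by rewrite big_split /= -mulr_sumr -/(geo_sum n t); ring.
Qed.

Lemma geo_sumE (R : fieldType) n (s : R) : (1 - s) * geo_sum n s = s * (1 - s ^+ n).
Proof.
rewrite /geo_sum; elim: n => [|n IHn]; first by rewrite big_ord0; ring.
by rewrite big_ord_recr /= mulrDr IHn !exprS; ring.
Qed.

(** For a fixed larger exponent [i] the sum over the smaller one is geometric, and [1 - t] times it
    leaves [2 * t * s ^ i - (1 + t) * (s * t) ^ i]. *)
Lemma maxmin_sumE (R : fieldType) n (s t : R) :
  (1 - t) * maxmin_sum n s t = 2 * t * geo_sum n s - (1 + t) * geo_sum n (s * t).
Proof.
elim: n => [|n IHn].
  by rewrite /maxmin_sum /geo_sum !big_ord0; ring.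
rewrite maxmin_sumS !mulrDr IHn mulrCA geo_sumE.
rewrite [geo_sum n.+1 s]big_ord_recr [geo_sum n.+1 (s * t)]big_ord_recr /=.
rewrite -/(geo_sum n s) -/(geo_sum n (s * t)) !exprMn !exprS; ring.
Qed.

Lemma sum_pdepth_div (R : realType) M n (G : nat -> R) : (0 < M)%N ->
  \sum_(x < M ^ n) G (pdepth M n x) *+ (0 < x)%N =
  M%:R ^+ n * (M%:R - 1) * \sum_(i < n) G i.+1 / M%:R ^+ i.+1.
Proof.
move=> M0; rewrite sum_pdepth // mulr_sumr; apply: eq_bigr => i _.
have M_neq0 : (M%:R : R) != 0 by rewrite pnatr_eq0 -lt0n.
rewrite -[in M%:R ^+ n](subnK (ltn_ord i)) exprD -[G _ *+ _]mulr_natr natrM natrX.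
rewrite -subn1 natrB //; set u := M%:R ^+ i.+1; have u0 : u != 0 by rewrite expf_neq0.
by field.
Qed.

Lemma geo_sum_pdepth (R : realType) M n (p : R) : (0 < M)%N ->
  \sum_(x < M ^ n) p ^+ pdepth M n x *+ (0 < x)%N =
  M%:R ^+ n * (M%:R - 1) * geo_sum n (p / M%:R).
Proof.
move=> M0; rewrite (sum_pdepth_div n (fun a => p ^+ a)) //; congr (_ * _).
by apply: eq_bigr => i _; rewrite expr_div_n.
Qed.

Lemma maxmin_sum_pdepth (R : realType) M n (p : R) : (0 < M)%N ->
  \sum_(x < M ^ n) \sum_(y < M ^ n)
    (let a := pdepth M n x in let b := pdepth M n y in
    (- 2 * p ^+ maxn a b + 4 * p ^+ (a + b) - p ^+ (a + b + minn a b))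
         *+ ((0 < x) && (0 < y))%N) =
  (M%:R ^+ n * (M%:R - 1)) ^+ 2 *
    (- 2 * maxmin_sum n (p / M%:R) (1 / M%:R) + 4 * geo_sum n (p / M%:R) ^+ 2
     - maxmin_sum n (p / M%:R) (p ^+ 2 / M%:R)).
Proof.
move=> M0; set m : R := M%:R; set K := m ^+ n * (m - 1).
have m0 : m != 0 by rewrite pnatr_eq0 -lt0n.
pose F a b := - 2 * p ^+ maxn a b + 4 * p ^+ (a + b) - p ^+ (a + b + minn a b).
pose H a := \sum_(j < n) F a j.+1 / m ^+ j.+1.
transitivity (\sum_(x < M ^ n) (K * H (pdepth M n x)) *+ (0 < x)%N).
  apply: eq_bigr => x _; rewrite /K /H -(sum_pdepth_div n (F (pdepth M n x))) //.
  by rewrite -sumrMnl; apply: eq_bigr => y _; rewrite -mulrnA mulnb andbC.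
rewrite (sum_pdepth_div n (fun a => K * H a)) // -/m -/K expr2.
rewrite -mulrA; congr (K * _).
rewrite expr2 /geo_sum big_distrlr /= /maxmin_sum !mulr_sumr -big_split /= -sumrB.
rewrite mulr_sumr; apply: eq_bigr => i _; rewrite -mulrA; congr (K * _).
rewrite /H mulr_suml !mulr_sumr -big_split /= -sumrB.
apply: eq_bigr => j _.
(* Since [maxn] and [minn] add up to the sum of the depths, the weight [m] to minus that sum splits
   between the two powers, giving the bases [p / m], [1 / m] and [p ^ 2 / m]. *)
have mm : ((maxn i j).+1 + (minn i j).+1 = i.+1 + j.+1)%N by lia.
have e (z : R) : z ^+ i.+1 * z ^+ j.+1 = z ^+ (maxn i j).+1 * z ^+ (minn i j).+1.
  by rewrite -!exprD mm.
have nz k : m ^+ k != 0 by rewrite expf_neq0.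
rewrite -[LHS]mulrA -invfM (mulrC (m ^+ j.+1)) !e.
rewrite /F !expr_div_n maxnSS minnSS expr1n -mm !exprD -exprM mul2n -addnn exprD.
by field; rewrite !nz.
Qed.

(** * Limits and normalisation *)

Lemma cvg_geo_sum (R : realType) (s : R) : `|s| < 1 ->
  geo_sum n s @[n --> \oo] --> s / (1 - s).
Proof.
move=> s1; have := cvg_geometric_series (a := s) s1.
apply: cvg_trans; apply: near_eq_cvg; near=> n.
rewrite /series /= big_mkord; apply: eq_bigr => i _; by rewrite exprS.
Unshelve. all: by end_near.
Qed.

Lemma cvg_maxmin_sum (R : realType) (s t : R) : `|s| < 1 -> `|t| < 1 ->
  maxmin_sum n s t @[n --> \oo] -->
  (2 * t * (s / (1 - s)) - (1 + t) * (s * t / (1 - s * t))) / (1 - t).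
Proof.
move=> s1 t1.
have t0 : 1 - t != 0 by rewrite subr_eq0; apply: contraTneq t1 => <-; rewrite normr1 ltxx.
have -> : (fun n => maxmin_sum n s t) = fun n => (2 * t * geo_sum n s - (1 + t) * geo_sum n (s * t)) / (1 - t).
  by apply/funext => n; rewrite -maxmin_sumE mulrC mulKf.
apply: cvgMl; apply: cvgB; apply: cvgMr; apply: cvg_geo_sum => //.
by rewrite normrM mulr_ilt1.
Qed.

(** The contribution of the inner grid vertices, divided by [(m ^ n * (m - 1)) ^ 2]. *)
Definition vertex_sum (R : realType) (M n : nat) (p : R) : R :=
  let m := M%:R in
  - 2 * maxmin_sum n (p / m) (1 / m) + 4 * geo_sum n (p / m) ^+ 2
  - maxmin_sum n (p / m) (p ^+ 2 / m).

Lemma EVk_geo_sum (R : realType) M n k (p : R) : (0 < M)%N ->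
  let m : R := M%:R in let N := m ^+ n in
  let V a b := Vbox (R := R) k (a / N) (b / N) in
  EVk M p k n = (m ^+ 2 * p) ^+ n * (V 1 1 - (V 0 1 + V 1 0) * ((m - 1) * geo_sum n (p / m))
    + V 0 0 * ((m - 1) ^+ 2 * vertex_sum M n p)).
Proof.
move=> M0 m N V; rewrite EVk_pdepth /= natrX -/m -/N -!/(V _ _).
have sumc (c : R) : \sum_(x < M ^ n) c = N * c.
  by rewrite sumr_const card_ord -mulr_natl natrX.
pose P (x : 'I_(M ^ n)) := p ^+ pdepth M n x *+ (0 < x)%N.
pose W (x y : 'I_(M ^ n)) := let a := pdepth M n x in let b := pdepth M n y in
    (- 2 * p ^+ maxn a b + 4 * p ^+ (a + b) - p ^+ (a + b + minn a b))
         *+ ((0 < x) && (0 < y))%N.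
transitivity (p ^+ n * \sum_x \sum_y
    (V 1 1 - V 0 1 * P x - V 1 0 * P y + V 0 0 * W x y)).
  by congr (_ * _); apply: eq_bigr => x _; apply: eq_bigr => y _; rewrite /P /W !mulrnAr.
under eq_bigr => x _ do rewrite big_split /= !sumrB !sumc -!mulr_sumr.
rewrite big_split /= !sumrB !sumc -!mulr_sumr.
rewrite geo_sum_pdepth // maxmin_sum_pdepth // /vertex_sum -/m -/N.
rewrite [(m ^+ 2 * p) ^+ n]exprMn [(m ^+ 2) ^+ n]exprAC -/N; ring.
Qed.

(** As [m] to the power [D] is [m ^ 2 * p], the real power is a ratio of natural powers, whose
    denominator cancels the prefactor in [EVk_geo_sum]. *)
Lemma powR_scale (R : realType) (m p : R) k n : 1 < m -> 0 < p ->
  (1 / m) `^ (n%:R * (ln (m ^+ 2 * p) / ln m - k%:R)) = (m ^+ k) ^+ n / (m ^+ 2 * p) ^+ n.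
Proof.
move=> m1 p0; have m0 : 0 < m by lra.
have lm : ln m != 0 by rewrite gt_eqF // ln_gt0.
have q0 : 0 < m ^+ 2 * p by rewrite mulr_gt0 // exprn_gt0.
rewrite [n%:R * _]mulrC powRrM powR_mulrn ?powR_ge0 //.
rewrite -[RHS]expr_div_n; congr (_ ^+ n).
rewrite /powR gt_eqF ?divr_gt0 // div1r lnV ?posrE //.
rewrite (_ : _ * - ln m = ln (m ^+ k) - ln (m ^+ 2 * p)); last first.
  by rewrite (lnXn k m0) -mulr_natl; field.
by rewrite expRD expRN !lnK // posrE exprn_gt0.
Qed.

Theorem theorem1p2 (R : realType) (M : nat) (p : R) :
  (2 <= M)%N -> 1 / (M%:R ^+ 2) < p -> p <= 1 ->
  let m : R := M%:R in
  let r : R := 1 / m in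
  let D : R := ln (m ^+ 2 * p) / ln m in
  let Vbar (k : nat) : nat -> R :=
    fun n => r `^ (n%:R * (D - k%:R)) * EVk M p k n in
  [/\ Vbar 2%N n @[n --> \oo] --> (1 : R),
      Vbar 1%N n @[n --> \oo] --> (2 * m * (1 - p) / (m - p) : R) &
      Vbar 0%N n @[n --> \oo] --> (
        1 - 2 * p * (m - 1) ^+ 2 / (m - p)
              * (3 / (m - 1) - 4 * p / (m - p) + p ^+ 2 / (m - p ^+ 2))
          + 2 * p * (m ^+ 2 - 1) / (m ^+ 2 - p)
          - 4 * p ^+ 2 * (m - 1) ^+ 2 / (m - p) ^+ 2
          + p ^+ 3 * (m - 1) ^+ 2 * (m + p ^+ 2)
              / ((m - p ^+ 2) * (m ^+ 2 - p ^+ 3)) : R)].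
Proof.
move=> M2 pM p1 m r D Vbar.
have M0 : (0 < M)%N by lia.
have m2 : 2 <= m by rewrite /m (ler_nat R 2 M).
have p0 : 0 < p by apply: le_lt_trans pM; rewrite divr_ge0 // exprn_ge0 // ler0n.
have q0 n : (m ^+ 2 * p) ^+ n != 0.
  by rewrite expf_neq0 // gt_eqF // mulr_gt0 // exprn_gt0 //; lra.
have N0 n : m ^+ n != 0 by rewrite expf_neq0 // gt_eqF //; lra.
have lt1 (z : R) : 0 <= z <= 1 -> `|z / m| < 1.
  move=> /andP[z0 z1]; rewrite ger0_norm ?divr_ge0 ?ler0n // ltr_pdivrMr; lra.
have p_sq : 0 <= p ^+ 2 <= 1 by rewrite exprn_ge0 ?exprn_ile1 // ltW.
have u1 : `|p / m| < 1 by apply: lt1; rewrite ltW.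
have VbarE k n : Vbar k n = (m ^+ k) ^+ n *
   (Vbox k (1 / m ^+ n) (1 / m ^+ n) - (Vbox k 0 (1 / m ^+ n) + Vbox k (1 / m ^+ n) 0)
      * ((m - 1) * geo_sum n (p / m)) + Vbox k 0 0 * ((m - 1) ^+ 2 * vertex_sum M n p)).
  rewrite /Vbar /D /r powR_scale //; last lra.
  by rewrite EVk_geo_sum // -/m !mul0r mulrA mulfVK.
split.
(* Degenerate boxes have area 0, so only single squares count. *)
- rewrite (_ : Vbar 2%N = fun=> 1); first exact: cvg_cst.
  apply/funext => n; rewrite VbarE /= exprAC; have := N0 n.
  by move: (m ^+ n) => N N_neq0; field.
(* Points have [Vbox 1] equal to 0, so single squares and edge pairs remain. *)
- rewrite (_ : Vbar 1%N = fun n => 2 - 2 * ((m - 1) * geo_sum n (p / m))).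
    rewrite (_ : 2 * m * (1 - p) / (m - p) = 2 - 2 * ((m - 1) * ((p / m) / (1 - p / m)))); last by field; lra.
    apply: cvgB; first exact: cvg_cst.
    by apply: cvgMr; apply: cvgMr; exact: cvg_geo_sum.
  apply/funext => n; rewrite VbarE /= expr1; have := N0 n.
  by move: (m ^+ n) => N N_neq0; field.
(* Every nonempty box has Euler characteristic 1, so the vertex terms enter too. *)
- rewrite (_ : Vbar 0%N = fun n => 1 - 2 * ((m - 1) * geo_sum n (p / m))
      + (m - 1) ^+ 2 * vertex_sum M n p); last first.
    by apply/funext => n; rewrite VbarE /= expr0 expr1n; ring.
  set L := (X in _ --> X).
  pose mx (s t : R) := (2 * t * (s / (1 - s)) - (1 + t) * (s * t / (1 - s * t))) / (1 - t).
  have -> : L = 1 - 2 * ((m - 1) * ((p / m) / (1 - p / m))) +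
      (m - 1) ^+ 2 * (- 2 * mx (p / m) (1 / m) + 4 * ((p / m) / (1 - p / m)) ^+ 2
        - mx (p / m) (p ^+ 2 / m)).
    have /andP[p_sq0 p_sq1] := p_sq.
    (* These bounds make denominators such as [m ^ 2 - p ^ 3] positive. *)
    have p_cb : p * p ^+ 2 <= 1 by rewrite mulr_ile1 // ltW.
    have m_sq : 2 * 2 <= m * m by rewrite ler_pM.
    by rewrite /L /mx; field; rewrite -/m; do ! [apply/andP; split];
      rewrite gt_eqF //; lra.
  apply: cvgD; first apply: cvgB; first exact: cvg_cst.
    by apply: cvgMr; apply: cvgMr; exact: cvg_geo_sum.
  apply: cvgMr; apply: cvgB; last by apply: cvg_maxmin_sum => //; exact: lt1.
  apply: cvgD; first by apply: cvgMr; apply: cvg_maxmin_sum => //; apply: lt1; rewrite ler01 lexx.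
  apply: cvgMr; rewrite expr2; under eq_fun do rewrite expr2.
  by apply: cvgM; exact: cvg_geo_sum.
Qed.
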